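(* Let $\mathcal{T}$ and $\mathcal{C}\subseteq\mathcal{T}$ be as in the context. Assume $\mathcal{C}$ is functorially finite in $\mathcal{T}$ and $C\in\mathcal{C}$ is an indecomposable $\operatorname{Ext}$-projective object of $\mathcal{C}$. Then there is a left-weak Auslander-Reiten triangle in $\mathcal{C}$ of the form $$X\xrightarrow{\xi} B\xrightarrow{\beta} C\xrightarrow{\gamma}\Sigma X.$$ Given such a triangle, let $\widetilde{\mathcal{C}}\subseteq\mathcal{T}$ be the additive subcategory with $\operatorname{Ind}\widetilde{\mathcal{C}}=\operatorname{Ind}(\mathcal{C})\setminus\{C\}$ and define $\mathcal{C}':=\operatorname{add}(\widetilde{\mathcal{C}}\cup\{X\})$. Then: (a) If $X\in P(\mathcal{C}')\cap I(\mathcal{C}')$, then $\mathcal{C}'$ is closed under extensions. (b) If $\operatorname{End}(X)$ and $\operatorname{End}(C)$ are division rings and $\mathcal{C}'$ is closed under extensions, then $X\in I(\mathcal{C}')$. (c) If $\operatorname{End}(C)$ is a division ring, $\mathcal{C}'$ is closed under extensions and $X\in P(\mathcal{C}')$, then $X\in I(\mathcal{C}')$.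
   Context: Setting: $k$ is a field; $\mathcal{T}$ is a skeletally small $k$-linear triangulated category with suspension $\Sigma$, with split idempotents and with all $\operatorname{Hom}$ spaces finite dimensional over $k$ (so $\mathcal{T}$ is Krull-Schmidt), and $\mathcal{T}$ has a Serre functor $S$. An additive subcategory means a full subcategory closed under isomorphisms, (finite direct) sums and direct summands; $\operatorname{add}(-)$ denotes the smallest additive subcategory containing the given objects. A subcategory is closed under extensions if for every distinguished triangle $A\to B\to C\to\Sigma A$ with $A,C$ in it, $B$ is in it. $\mathcal{C}$ is an additive subcategory of $\mathcal{T}$ closed under extensions. For an additive subcategory $\mathcal{X}$, $\operatorname{Ind}\mathcal{X}$ is a maximal set of pairwise non-isomorphic indecomposable objects of $\mathcal{X}$ (indecomposables are considered up to isomorphism). $\operatorname{Ext}^1(X,Y):=\operatorname{Hom}_{\mathcal{T}}(X,\Sigma Y)$. For an additive subcategory $\mathcal{X}\subseteq\mathcal{T}$, an object $C\in\mathcal{X}$ is $\operatorname{Ext}$-projective in $\mathcal{X}$ if $\operatorname{Ext}^1(C,A)=0$ for all $A\in\mathcal{X}$, and $\operatorname{Ext}$-injective in $\mathcal{X}$ if $\operatorname{Ext}^1(A,C)=0$ for all $A\in\mathcal{X}$. $P(\mathcal{X})$ (resp. $I(\mathcal{X})$) is the additive subcategory of all $\operatorname{Ext}$-projective (resp. $\operatorname{Ext}$-injective) objects of $\mathcal{X}$. A morphism $\beta:B\to C$ with $B,C\in\mathcal{C}$ is right almost split in $\mathcal{C}$ if it is not a split epimorphism and every morphism $C'\to C$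 with $C'\in\mathcal{C}$ which is not a split epimorphism factors through $\beta$. A morphism $\xi:X\to Y$ is right minimal if $\xi\circ\varphi=\xi$ with $\varphi:X\to X$ implies $\varphi$ is an automorphism; left minimal if $\varphi\circ\xi=\xi$ with $\varphi:Y\to Y$ implies $\varphi$ is an automorphism. Minimal right almost split in $\mathcal{C}$ means right minimal and right almost split in $\mathcal{C}$. A $\mathcal{C}$-precover of $X\in\mathcal{T}$ is a morphism $A\to X$ with $A\in\mathcal{C}$ through which every morphism from an object of $\mathcal{C}$ to $X$ factors; a $\mathcal{C}$-preenvelope of $X$ is a morphism $X\to B$ with $B\in\mathcal{C}$ through which every morphism from $X$ to an object of $\mathcal{C}$ factors; a $\mathcal{C}$-envelope is a left minimal $\mathcal{C}$-preenvelope. $\mathcal{C}$ is functorially finite in $\mathcal{T}$ if every object of $\mathcal{T}$ has a $\mathcal{C}$-precover and a $\mathcal{C}$-preenvelope. A distinguished triangle $X\xrightarrow{\xi}B\xrightarrow{\beta}C\xrightarrow{\gamma}\Sigma X$ in $\mathcal{T}$ is a left-weak Auslander-Reiten triangle in $\mathcal{C}$ if $C$ is $\operatorname{Ext}$-projective in $\mathcal{C}$, $\beta$ is a minimal right almost split morphism in $\mathcal{C}$, and $\xi$ is a $\mathcal{C}$-envelope of $X$. *)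

(* Defs.v *)
From mathcomp Require Import all_boot all_order all_algebra.

Set Implicit Arguments.
Unset Strict Implicit.
Unset Printing Implicit Defensive.

Import GRing.Theory.
Local Open Scope ring_scope.

(** A k-linear category with finite dimensional Hom spaces: finite
    dimensionality over k is part of [vectType k]. Only bilinearity of the
    composition is required here; zero objects and biproducts come with
    [triCat] below. *)
Record linCat (k : fieldType) := LinCat {
  obj :> Type;
  Mor : obj -> obj -> vectType k;
  idm : forall X, Mor X X;
  mcomp : forall X Y Z, Mor Y Z -> Mor X Y -> Mor X Z;
  comp1m : forall X Y (f : Mor X Y), mcomp (idm Y) f = f;
  compm1 : forall X Y (f : Mor X Y), mcomp f (idm X) = f;
  compA : forall X Y Z W (h : Mor Z W) (g : Mor Y Z) (f : Mor X Y),
    mcomp h (mcomp g f) = mcomp (mcomp h g) f;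
  comp_linl : forall X Y Z (f : Mor X Y), linear (fun g : Mor Y Z => mcomp g f);
  comp_linr : forall X Y Z (g : Mor Y Z), linear (fun f : Mor X Y => mcomp g f)
}.

Arguments Mor {k l} X Y.
Arguments idm {k l} X.
Arguments mcomp {k l X Y Z} g f.

Notation "g \c f" := (mcomp g f) (at level 40, left associativity) : ring_scope.

Section Category.
Variables (k : fieldType) (T : linCat k).
Implicit Types X Y Z A B P : T.

Definition is_iso X Y (f : Mor X Y) : Prop :=
  exists g : Mor Y X, g \c f = idm X /\ f \c g = idm Y.

Definition isom X Y : Prop := exists f : Mor X Y, is_iso f.

Definition is_zero X : Prop := idm X = 0.

Definition is_biproduct A B P : Prop :=
  exists (i1 : Mor A P) (i2 : Mor B P) (p1 : Mor P A) (p2 : Mor P B),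
    [/\ p1 \c i1 = idm A, p2 \c i2 = idm B, p2 \c i1 = 0, p1 \c i2 = 0
      & i1 \c p1 + i2 \c p2 = idm P].

Definition indecomposable X : Prop :=
  ~ is_zero X /\
  forall A B, is_biproduct A B X -> is_zero A \/ is_zero B.

Definition split_epi X Y (f : Mor X Y) : Prop :=
  exists s : Mor Y X, f \c s = idm Y.

Definition right_minimal X Y (f : Mor X Y) : Prop :=
  forall p : Mor X X, f \c p = f -> is_iso p.

Definition left_minimal X Y (f : Mor X Y) : Prop :=
  forall p : Mor Y Y, p \c f = f -> is_iso p.

Definition split_idempotents : Prop :=
  forall X (e : Mor X X), e \c e = e ->
  exists Y (i : Mor Y X) (p : Mor X Y), p \c i = idm Y /\ i \c p = e.

(** The carrier of [I] lives in the universe of MathComp's structures, as do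
    the Hom spaces, whereas the universe of the objects of [T] is not
    constrained by it: this is the requirement that the isomorphism classes
    form a set. *)
Definition skeletally_small : Prop :=
  exists (I : choiceType) (F : I -> T), forall X, exists i, isom X (F i).

Definition End_division_ring X : Prop :=
  idm X <> 0 /\ forall f : Mor X X, f <> 0 -> is_iso f.

(** ** Full subcategories, given by their classes of objects *)

(** Finite direct sums include the empty one. *)
Record additive_subcat (D : T -> Prop) : Prop := AdditiveSubcat {
  additive_iso : forall X Y, isom X Y -> D X -> D Y;
  additive_zero : forall X, is_zero X -> D X;
  additive_sum : forall A B P, is_biproduct A B P -> D A -> D B -> D P;
  additive_summand : forall A B P, is_biproduct A B P -> D P -> D A
}.

Definition addc (Q : T -> Prop) : T -> Prop := fun X =>
  forall D : T -> Prop, additive_subcat D -> (forall Y, Q Y -> D Y) -> D X.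

(** Indecomposables are taken up to isomorphism: for an additive subcategory
    [D] (closed under isomorphisms) a set of isomorphism classes is encoded by
    the isomorphism-closed class of its members. *)
Definition Ind (D : T -> Prop) : T -> Prop := fun X => indecomposable X /\ D X.

Definition precover (D : T -> Prop) A X (f : Mor A X) : Prop :=
  D A /\ forall A' (g : Mor A' X), D A' -> exists h : Mor A' A, f \c h = g.

Definition preenvelope (D : T -> Prop) X B (f : Mor X B) : Prop :=
  D B /\ forall B' (g : Mor X B'), D B' -> exists h : Mor B B', h \c f = g.

Definition envelope (D : T -> Prop) X B (f : Mor X B) : Prop :=
  preenvelope D f /\ left_minimal f.

Definition functorially_finite (D : T -> Prop) : Prop :=
  forall X, (exists A (f : Mor A X), precover D f) /\
            (exists B (f : Mor X B), preenvelope D f).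

Definition right_almost_split (D : T -> Prop) B C (b : Mor B C) : Prop :=
  [/\ D B, D C, ~ split_epi b &
    forall C' (c : Mor C' C), D C' -> ~ split_epi c ->
    exists h : Mor C' B, b \c h = c].

Definition minimal_right_almost_split (D : T -> Prop) B C (b : Mor B C) : Prop :=
  right_minimal b /\ right_almost_split D b.

End Category.

Record linFunctor (k : fieldType) (S T : linCat k) := LinFunctor {
  fobj :> S -> T;
  fmap : forall X Y : S, {linear Mor X Y -> Mor (fobj X) (fobj Y)};
  fmap1 : forall X : S, fmap X X (idm X) = idm (fobj X);
  fmap_comp : forall (X Y Z : S) (g : Mor Y Z) (f : Mor X Y),
    fmap X Z (g \c f) = fmap Y Z g \c fmap X Y f
}.

Arguments fmap {k S T} F {X Y} : rename.

Definition is_equivalence (k : fieldType) (S T : linCat k)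
    (F : linFunctor S T) : Prop :=
  exists (G : linFunctor T S)
         (u : forall X : S, Mor X (G (F X)))
         (v : forall Y : T, Mor (F (G Y)) Y),
    [/\ forall X, is_iso (u X),
        forall Y, is_iso (v Y),
        forall (X X' : S) (f : Mor X X'), u X' \c f = fmap G (fmap F f) \c u X
      & forall (Y Y' : T) (g : Mor Y Y'), v Y' \c fmap F (fmap G g) = g \c v Y].

(** A Serre functor: an autoequivalence [S] with isomorphisms
    Hom(X, Y) = D Hom(Y, S X), natural in X and Y, where D is the k-dual. *)
Record serreFunctor (k : fieldType) (T : linCat k) := SerreFunctor {
  serre :> linFunctor T T;
  serre_equivalence : is_equivalence serre;
  serre_iso : forall X Y : T,
    {linear Mor X Y -> 'Hom(Mor Y (serre X), k^o)};
  serre_bij : forall X Y : T, bijective (serre_iso X Y);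
  serre_natural : forall (X X' Y Y' : T) (a : Mor X' X) (b : Mor Y Y')
      (f : Mor X Y) (g : Mor Y' (serre X')),
    serre_iso X' Y' (b \c f \c a) g = serre_iso X Y f (fmap serre a \c g \c b)
}.

(** The suspension is an autoequivalence, not necessarily invertible on the
    nose. *)
Record triCat (k : fieldType) := TriCat {
  tri_cat :> linCat k;
  tri_zero : exists Z : tri_cat, is_zero Z;
  tri_biproduct : forall A B : tri_cat, exists P, is_biproduct A B P;
  susp : linFunctor tri_cat tri_cat;
  susp_equivalence : is_equivalence susp;
  dist : forall X Y Z : tri_cat, Mor X Y -> Mor Y Z -> Mor Z (susp X) -> Prop;
  dist_iso : forall (X Y Z X' Y' Z' : tri_cat)
      (f : Mor X Y) (g : Mor Y Z) (h : Mor Z (susp X))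
      (f' : Mor X' Y') (g' : Mor Y' Z') (h' : Mor Z' (susp X'))
      (a : Mor X X') (b : Mor Y Y') (c : Mor Z Z'),
    is_iso a -> is_iso b -> is_iso c ->
    b \c f = f' \c a -> c \c g = g' \c b -> fmap susp a \c h = h' \c c ->
    dist f g h -> dist f' g' h';
  dist_id : forall X Z : tri_cat, is_zero Z ->
    dist (idm X) (0 : Mor X Z) (0 : Mor Z (susp X));
  dist_cone : forall (X Y : tri_cat) (f : Mor X Y),
    exists Z (g : Mor Y Z) (h : Mor Z (susp X)), dist f g h;
  dist_rotate : forall (X Y Z : tri_cat)
      (f : Mor X Y) (g : Mor Y Z) (h : Mor Z (susp X)),
    dist f g h <-> dist g h (- fmap susp f);
  dist_fill : forall (X Y Z X' Y' Z' : tri_cat)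
      (f : Mor X Y) (g : Mor Y Z) (h : Mor Z (susp X))
      (f' : Mor X' Y') (g' : Mor Y' Z') (h' : Mor Z' (susp X'))
      (a : Mor X X') (b : Mor Y Y'),
    dist f g h -> dist f' g' h' -> b \c f = f' \c a ->
    exists c : Mor Z Z', c \c g = g' \c b /\ fmap susp a \c h = h' \c c;
  dist_octahedron : forall (X Y Z Z' X' Y' : tri_cat)
      (f : Mor X Y) (a : Mor Y Z') (b : Mor Z' (susp X))
      (g : Mor Y Z) (c : Mor Z X') (d : Mor X' (susp Y))
      (e : Mor Z Y') (h : Mor Y' (susp X)),
    dist f a b -> dist g c d -> dist (g \c f) e h ->
    exists (u : Mor Z' Y') (v : Mor Y' X'),
      dist u v (fmap susp a \c d) /\
      [/\ u \c a = e \c g, h \c u = b, v \c e = c & d \c v = fmap susp f \c h]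
}.

Arguments susp {k t}.
Arguments dist {k t X Y Z} f g h.

Section Triangulated.
Variables (k : fieldType) (T : triCat k).

Definition Ext1 (X Y : T) : vectType k := Mor X (susp Y).

Definition extension_closed (D : T -> Prop) : Prop :=
  forall (A B E : T) (f : Mor A B) (g : Mor B E) (h : Mor E (susp A)),
    dist f g h -> D A -> D E -> D B.

Definition Ext_projectives (D : T -> Prop) : T -> Prop := fun X =>
  D X /\ forall A : T, D A -> forall f : Ext1 X A, f = 0.

Definition Ext_injectives (D : T -> Prop) : T -> Prop := fun X =>
  D X /\ forall A : T, D A -> forall f : Ext1 A X, f = 0.

Definition left_weak_AR_triangle (D : T -> Prop) (X B C : T)
    (xi : Mor X B) (beta : Mor B C) (gamma : Mor C (susp X)) : Prop :=
  [/\ dist xi beta gamma, Ext_projectives D C,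
      minimal_right_almost_split D beta & envelope D xi].

End Triangulated.

(* Main.v *)
Require Import Defs.
From HB Require Import structures.
From mathcomp Require Import all_boot all_order all_algebra.
From Stdlib Require Import Classical.

(** Existence. Among the nonzero maps out of [C] into its image under the Serre
    functor, one that generates an End(C)-submodule of minimal dimension is
    killed by the non-invertible endomorphisms of [C]; by Serre duality it is
    then killed by every map into [C] that is not a split epimorphism
    ([serre_socle]). Composing its fibre with a precover by CC gives a right
    almost split map, from which a right minimal version is split off. The
    fibre [X] of the resulting map [beta] is a preenvelope because [C] is
    Ext-projective, and it is left minimal because an idempotent of [B] that
    kills [xi] is conjugate to one of [C] that factors through [beta].

    Throughout, five-lemma and Krull-Schmidt arguments are replaced by two
    devices. An endomorphism of an object is invertible unless a nonzero
    idempotent kills everything it fixes ([iso_or_idempotent]). Membership in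
    CC' is read off from a decomposition of the identity into a map through Ct
    and a map through add(X) ([CC'_decomp]), and conversely an object whose
    identity factors through an additive subcategory lies in it ([thru_id]).

    The facts behind (a), (b) and (c) are that [gamma] is not zero, that it
    kills every map from CC to [C] which is not a split epimorphism
    ([gamma_kill]), and that an object of CC without a summand [C] lies in Ct
    ([Ct_of_CC]).

    For (a), in an extension of [E] by [A] with both in Ct, a summand [C] of the
    middle term would make [gamma] factor through a map from [E] to the
    suspension of [X], hence vanish ([Ct_extension]). The general case reduces
    to this one since the copies of [X] contribute nothing to the connecting
    map.

    For (b) and (c), let a nonzero [delta] from [A] to the suspension of [X]
    define a triangle from [X] by [m] to [M] and on to [A], and let [N] be the
    pushout of [m] and [xi] ([homotopy_pushout]): an extension of [A] by [B],
    and also of [C] by [M] with connecting map the composite of [gamma] with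
    the suspension of [m]. As End(C) is a division ring, [B] lies in Ct
    ([B_in_Ct]), so [N] is in CC'; but [C] is not in CC'. In (b), [m] factors
    through [xi], so that connecting map vanishes and [C] is a summand of [N].
    In (c), where [A] may be taken in Ct, [N] lies in CC, so [gamma] kills the
    map from [N] to [C] and factors through that connecting map; by minimality
    of [beta] this makes [m] a split monomorphism ([iso_of_fix_gamma]). Both
    are contradictory. *)

Set Implicit Arguments.
Unset Strict Implicit.
Unset Printing Implicit Defensive.

Import GRing.Theory.
Local Open Scope ring_scope.

(** [compA] also names the associativity of function composition. *)
Notation mcompA := Defs.compA.

(** * Linear categories *)

Section Bilinear.
Variables (k : fieldType) (T : linCat k).

Definition precomp (X Y Z : T) (f : Mor X Y) (g : Mor Y Z) := g \c f.
HB.instance Definition _ (X Y Z : T) (f : Mor X Y) :=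
  GRing.isLinear.Build k (Mor Y Z) (Mor X Z) *:%R (precomp f) (comp_linl f).

Definition postcomp (X Y Z : T) (g : Mor Y Z) (f : Mor X Y) := g \c f.
HB.instance Definition _ (X Y Z : T) (g : Mor Y Z) :=
  GRing.isLinear.Build k (Mor X Y) (Mor X Z) *:%R (postcomp g) (comp_linr g).

Lemma comp0m (X Y Z : T) (f : Mor X Y) : (0 : Mor Y Z) \c f = 0.
Proof. exact: (linear0 (precomp f)). Qed.
Lemma compm0 (X Y Z : T) (g : Mor Y Z) : g \c (0 : Mor X Y) = 0.
Proof. exact: (linear0 (postcomp g)). Qed.
Lemma compDm (X Y Z : T) (f : Mor X Y) (g g' : Mor Y Z) :
  (g + g') \c f = g \c f + g' \c f.
Proof. exact: (linearD (precomp f)). Qed.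
Lemma compmD (X Y Z : T) (f f' : Mor X Y) (g : Mor Y Z) :
  g \c (f + f') = g \c f + g \c f'.
Proof. exact: (linearD (postcomp g)). Qed.
Lemma compNm (X Y Z : T) (f : Mor X Y) (g : Mor Y Z) : (- g) \c f = - (g \c f).
Proof. exact: (linearN (precomp f)). Qed.
Lemma compmN (X Y Z : T) (f : Mor X Y) (g : Mor Y Z) : g \c (- f) = - (g \c f).
Proof. exact: (linearN (postcomp g)). Qed.
Lemma compBm (X Y Z : T) (f : Mor X Y) (g g' : Mor Y Z) :
  (g - g') \c f = g \c f - g' \c f.
Proof. exact: (linearB (precomp f)). Qed.
Lemma compmB (X Y Z : T) (f f' : Mor X Y) (g : Mor Y Z) :
  g \c (f - f') = g \c f - g \c f'.
Proof. exact: (linearB (postcomp g)). Qed.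
Lemma compZm (X Y Z : T) (f : Mor X Y) a (g : Mor Y Z) :
  (a *: g) \c f = a *: (g \c f).
Proof. exact: (linearZ_LR (precomp f)). Qed.
Lemma compmZ (X Y Z : T) a (f : Mor X Y) (g : Mor Y Z) :
  g \c (a *: f) = a *: (g \c f).
Proof. exact: (linearZ_LR (postcomp g)). Qed.

Lemma zero_dom (X Y : T) (f : Mor X Y) : is_zero X -> f = 0.
Proof. by move=> X0; rewrite -(compm1 f) X0 compm0. Qed.

Lemma zero_cod (X Y : T) (f : Mor X Y) : is_zero Y -> f = 0.
Proof. by move=> Y0; rewrite -(comp1m f) Y0 comp0m. Qed.

(** An alias, so that the ring structure of End(X), with its powers, does not
    interfere with the vector space structure of Hom(X, X). *)
Definition endo (X : T) : Type := Mor X X.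
HB.instance Definition _ (X : T) := GRing.Lmodule.copy (endo X) (Mor X X).
HB.instance Definition _ (X : T) :=
  GRing.Zmodule_isPzRing.Build (endo X) (@Defs.compA k T X X X X)
    (@comp1m k T X X) (@compm1 k T X X) (fun f g h => compDm h f g)
    (fun f g h => compmD g h f).

Lemma iso_id (X : T) : is_iso (idm X).
Proof. by exists (idm X); rewrite comp1m. Qed.

Lemma is_iso_lr (X Y : T) (f : Mor X Y) (g g' : Mor Y X) :
  g \c f = idm X -> f \c g' = idm Y -> is_iso f.
Proof.
move=> gf fg'; exists g; split=> //.
by rewrite -{1}(compm1 g) -fg' (mcompA g) gf comp1m.
Qed.

Lemma split_epi_of_iso_comp (X Y : T) (f : Mor X Y) (g : Mor Y X) :
  is_iso (f \c g) -> split_epi f.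
Proof. by case=> s [_ fgs]; exists (g \c s); rewrite mcompA. Qed.

End Bilinear.
(** * Fitting idempotents and Krull-Schmidt arguments *)

Section KrullSchmidt.
Variables (k : fieldType) (T : linCat k).

(** Among the powers of [p] there is a linear relation; solving it for the
    lowest power that occurs gives [t], a polynomial in [p]. *)
Lemma power_stable (X : T) (p : endo X) :
  exists (n : nat) (t : endo X), p ^+ n = p ^+ n.+1 * t /\ p ^+ n = t * p ^+ n.+1.
Proof.
pose d := (\dim {:Mor X X}).+1.
pose s := [tuple (p ^+ i : Mor X X) | i < d].
have nfree : ~~ free s.
  apply/negP=> fs; have := dimvS (subvf <<s>>%VS).
  by rewrite (eqP fs) size_tuple ltnn.
have [c csum [i0 ci0]] : exists2 c : 'I_d -> k,
    \sum_(i < d) c i *: (p ^+ i : endo X) = 0 & exists i, c i != 0.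
  apply: NNPP => none; case/negP: nfree; apply/freeP => c c0 i.
  apply/eqP; case: eqP => // /eqP ci; case: none; exists c; last by exists i.
  by rewrite -[RHS]c0; apply: eq_bigr => j _; rewrite -tnth_nth tnth_mktuple.
have [a ca amin] : exists2 a : 'I_d, c a != 0 & forall i : 'I_d, (i < a)%N -> c i = 0.
  case: (@arg_minnP _ i0 (fun i => c i != 0) (fun i => i : nat) ci0) => a ca amin.
  exists a => // i ia; apply/eqP; case: eqP => // /eqP /amin.
  by rewrite leqNgt ia.
exists a; pose t : endo X := \sum_(i < d | (a < i)%N)
  (- ((c a)^-1 * c i)) *: (p ^+ (i - a.+1) : endo X).
have pa : p ^+ a = \sum_(i < d | (a < i)%N) (- ((c a)^-1 * c i)) *: (p ^+ i : endo X).
  have: (c a)^-1 *: \sum_(i < d) c i *: (p ^+ i : endo X) = 0.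
    by rewrite csum scaler0.
  rewrite (bigD1 a) //= scalerDr scalerA mulVf // scale1r => /eqP.
  rewrite addr_eq0 => /eqP ->; rewrite scaler_sumr -sumrN.
  rewrite (bigID (fun i : 'I_d => (a < i)%N)) /= addrC big1 ?add0r.
    apply: eq_big => [i|i _]; last by rewrite scaleNr scalerA.
    by rewrite andbC; case: ltnP => //= ai; rewrite -val_eqE gtn_eqF.
  move=> i /andP[ia]; rewrite -leqNgt leq_eqVlt (negPf (_ : val i != a)) //=.
  by move/amin ->; rewrite scale0r scaler0 oppr0.
exists t; split; rewrite {1}pa /t ?mulr_sumr ?mulr_suml; apply: eq_bigr => i ai.
  by rewrite [RHS]compmZ; congr (_ *: _); rewrite -[RHS]exprD subnKC.
by rewrite [RHS]compZm; congr (_ *: _); rewrite -[RHS]exprD subnK.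
Qed.

(** The idempotent projects onto the summand of [X] on which [p] is
    invertible, along the one on which it is nilpotent. *)
Lemma fitting (X : T) (p : endo X) : exists (n : nat) (e : endo X),
  [/\ e * e = e, p ^+ n * e = p ^+ n, e * p ^+ n = p ^+ n & e = 1 -> is_iso p].
Proof.
have [n [t [pr pl]]] := power_stable p.
have stepr m : p ^+ (m + n) = p ^+ (m + n).+1 * t.
  by rewrite exprD {1}pr mulrA -exprD addnS.
have stepl m : p ^+ (n + m) = t * p ^+ (n + m).+1.
  by rewrite exprD {1}pl -mulrA -exprD addSn.
have powr m : p ^+ n = p ^+ (m + n) * t ^+ m.
  by elim: m => [|m IH]; rewrite ?mulr1 // addSn (exprS t) mulrA -stepr.
have powl m : p ^+ n = t ^+ m * p ^+ (n + m).
  elim: m => [|m IH]; first by rewrite addn0 mul1r.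
  by rewrite addnS (exprSr t) -mulrA -stepl.
have tp : t ^+ n * p ^+ n = p ^+ n * t ^+ n.
  by rewrite {1}(powr n) mulrA -powl.
exists n, (p ^+ n * t ^+ n); split.
- by rewrite mulrA -(mulrA _ (t ^+ n)) tp (mulrA (p ^+ n)) -exprD -powr.
- by rewrite mulrA -exprD -powr.
- by rewrite -tp -mulrA -exprD -powl.
move=> e1; apply: (@is_iso_lr _ _ X X p (t ^+ n * t * p ^+ n) (p ^+ n * t * t ^+ n)).
  change (t ^+ n * t * p ^+ n * p = 1).
  by rewrite -mulrA -(exprSr p) -mulrA -[n.+1]addn0 addSn -stepl addn0 tp e1.
change (p * (p ^+ n * t * t ^+ n) = 1).
by rewrite !mulrA -(exprS p) -[n.+1]add0n addnS -(stepr 0) e1.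
Qed.

(** The form in which the Fitting idempotent is used: either [p] is invertible
    or there is a nonzero idempotent (the complementary one) that kills
    everything that [p] fixes, on either side. *)
Lemma iso_or_idempotent (X : T) (p : Mor X X) :
  is_iso p \/ exists f : Mor X X, [/\ f \c f = f, f <> 0,
    forall Y (b : Mor X Y), b \c p = b -> b \c f = 0
    & forall Y (b : Mor Y X), p \c b = b -> f \c b = 0].
Proof.
have [n [e [ee pe ep e1]]] := fitting p.
case: (eqVneq e 1) => [/e1|ne1]; first by left.
right; exists (idm X - e); split=> [|f0|Y b bp|Y b pb].
- rewrite -[LHS]/((1 - e) * (1 - e) : endo X).
  by rewrite mulrBr mulr1 mulrBl mul1r ee subrr subr0.
- by case/eqP: ne1; apply/eqP; rewrite eq_sym -subr_eq0; apply/eqP.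
- have bpn : b \c (p : endo X) ^+ n = b.
    elim: n {pe ep} => [|n IH]; first by rewrite compm1.
    by rewrite exprS -[_ * _]/(p \c _) mcompA bp.
  by rewrite compmB compm1 -{2}bpn -mcompA [_ \c e]pe bpn subrr.
have pnb : ((p : endo X) ^+ n : Mor X X) \c b = b.
  elim: n {pe ep} => [|n IH]; first by rewrite comp1m.
  by rewrite exprSr -[_ * _]/(_ \c p) -mcompA pb.
by rewrite compBm comp1m -{2}pnb mcompA [e \c _]ep pnb subrr.
Qed.

Definition retract (A X : T) : Prop :=
  exists (i : Mor A X) (p : Mor X A), p \c i = idm A.

Lemma biproductC (A B P : T) : is_biproduct A B P -> is_biproduct B A P.
Proof.
case=> [i1 [i2 [p1 [p2 [h1 h2 h3 h4 h5]]]]].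
by exists i2, i1, p2, p1; split; rewrite // addrC.
Qed.

Lemma summand_dim_lt (A B X : T) : is_biproduct A B X -> ~ is_zero B ->
  (\dim {:Mor A A} < \dim {:Mor X X})%N.
Proof.
case=> [i1 [i2 [p1 [p2 [h1 h2 h3 h4 h5]]]]] nz.
pose j : {linear Mor A A -> Mor X X} := postcomp i1 \o precomp p1.
have jinj : lker (linfun j) == 0%VS.
  apply/lker0P => f g; rewrite !lfunE /= /postcomp /precomp => fg.
  have := congr1 (fun u => p1 \c u \c i1) fg.
  by rewrite !mcompA h1 !comp1m -!mcompA h1 !compm1.
rewrite -(limg_dim_eq (eqP _ : (fullv :&: lker (linfun j) = 0)%VS)); last first.
  by rewrite capfv.
rewrite ltnNge; apply/negP => le.
have /vspaceP/(_ (idm X)) : (linfun j @: fullv)%VS = fullv.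
  by apply/eqP; rewrite eqEdim subvf.
rewrite memvf => /memv_imgP[f _]; rewrite lfunE /= /postcomp /precomp => idX.
apply: nz; rewrite /is_zero -h2 -[i2]comp1m idX -mcompA.
by rewrite -(mcompA f) h4 !compm0.
Qed.

(** Decompositions terminate, since a proper summand of [X] has a smaller
    endomorphism algebra. *)
Lemma krull_schmidt_ind (Q : T -> Prop) :
  (forall X, is_zero X -> Q X) -> (forall X, indecomposable X -> Q X) ->
  (forall A B P, is_biproduct A B P -> Q A -> Q B -> Q P) -> forall X, Q X.
Proof.
move=> Q0 Qi Qs X; have [n] := ubnP (\dim {:Mor X X}); elim: n X => // n IH X.
rewrite ltnS => dX.
case: (classic (is_zero X)) => [/Q0 //|X0].
case: (classic (indecomposable X)) => [/Qi //|Xdec].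
have [A [B [bip A0 B0]]] :
    exists A B, [/\ is_biproduct A B X, ~ is_zero A & ~ is_zero B].
  apply: NNPP => none; apply: Xdec; split=> // A B bip.
  by apply: NNPP => /not_or_and[A0 B0]; apply: none; exists A, B.
apply: (Qs A B X bip); apply: IH; apply: (leq_trans _ dX).
  exact: summand_dim_lt bip B0.
by apply: summand_dim_lt A0; apply: biproductC bip.
Qed.

Hypothesis idem : split_idempotents T.

Lemma idempotent_biproduct (X : T) (e : Mor X X) : e \c e = e ->
  exists (Y Z : T) (i : Mor Y X) (p : Mor X Y) (j : Mor Z X) (q : Mor X Z),
    [/\ is_biproduct Y Z X, i \c p = e, p \c i = idm Y, j \c q = idm X - e
      & q \c j = idm Z].
Proof.
move=> ee; have [Y [i [p [pi ip]]]] := idem ee.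
have ff : (idm X - e) \c (idm X - e) = idm X - e.
  by rewrite compmB compm1 compBm comp1m ee subrr subr0.
have [Z [j [q [qj jq]]]] := idem ff.
exists Y, Z, i, p, j, q; split=> //; exists i, j, p, q; split=> //.
- rewrite -[q]comp1m -qj -[i]compm1 -pi -!mcompA (mcompA i) ip (mcompA j) jq.
  by rewrite (mcompA (_ - _)) compBm comp1m ee subrr comp0m compm0.
- rewrite -[p]comp1m -pi -[j]compm1 -qj -!mcompA (mcompA j) jq (mcompA i) ip.
  by rewrite (mcompA e) compmB compm1 ee subrr comp0m compm0.
by rewrite ip jq addrC subrK.
Qed.

Lemma retract_closed (D : T -> Prop) (A X : T) :
  additive_subcat D -> retract A X -> D X -> D A.
Proof.
move=> addD [i [p pi]] DX.
have ee : (i \c p) \c (i \c p) = i \c p.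
  by rewrite -mcompA (mcompA p) pi comp1m.
have [Y [Z [i' [p' [_ [_ [bip ip' pi' _ _]]]]]]] := idempotent_biproduct ee.
apply: (additive_iso addD _ (additive_summand addD bip DX)).
exists (p \c i'), (p' \c i); split.
  by rewrite -mcompA (mcompA i) -ip' -!mcompA pi' compm1.
by rewrite -mcompA (mcompA i') ip' -!mcompA pi compm1.
Qed.

Section Indecomposable.
Variable C : T.
Hypothesis indC : indecomposable C.

Lemma indec_idempotent (e : Mor C C) : e \c e = e -> e = 0 \/ e = idm C.
Proof.
move=> ee.
have [Y [Z [i [p [j [q [bip ip pi jq qj]]]]]]] := idempotent_biproduct ee.
case: (indC.2 _ _ bip) => z0; [left|right].
  by rewrite -ip (zero_cod p z0) compm0.
by apply/esym/eqP; rewrite -subr_eq0 -jq (zero_cod q z0) compm0.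
Qed.

Lemma indec_split_epi_iso (r : Mor C C) : split_epi r -> is_iso r.
Proof.
case=> s rs; exists s; split=> //.
have ee : (s \c r) \c (s \c r) = s \c r by rewrite -mcompA (mcompA r) rs comp1m.
case: (indec_idempotent ee) => // sr0; case: indC.1.
by rewrite /is_zero -[idm C]comp1m -rs -mcompA (mcompA s) sr0 comp0m compm0.
Qed.

Lemma nonsplit_postcomp (C' : T) (g : Mor C' C) (f : Mor C C') :
  ~ split_epi g -> ~ is_iso (g \c f).
Proof. by move=> ng /split_epi_of_iso_comp. Qed.

(** End(C) is local: if [p] and [1 - p] were both non-invertible they would
    both be nilpotent, and so would be their sum. *)
Lemma indec_local (p : Mor C C) : is_iso p \/ is_iso (idm C - p).
Proof.
have nil (r : endo C) : ~ is_iso r -> exists n, r ^+ n = 0.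
  move=> nr; have [n [e [ee re _ e1]]] := fitting r; exists n; rewrite -re.
  by case: (indec_idempotent ee) => [->|/e1 //]; rewrite mulr0.
apply: NNPP => /not_or_and[/nil[m]].
set x : endo C := p => xm /nil[n]; rewrite -[idm C - p]/(1 - x) => xn.
case: indC.1; rewrite /is_zero -[LHS]/(1 : endo C) -(expr1n _ (m + n)).
rewrite -[X in X ^+ _](subrKC x 1) exprDn_comm; last first.
  by rewrite /GRing.comm mulrBr mulrBl mulr1 mul1r.
apply: big1 => i _; case: (leqP i n) => ni.
  by rewrite -(addnBA _ ni) (exprD x) xm !mul0r mul0rn.
by rewrite -(subnK (ltnW ni)) (exprD (1 - x)) xn !mulr0 mul0rn.
Qed.

Lemma indec_sum (X Y : T) (i : Mor C X) (p : Mor X C) (j : Mor C Y) (q : Mor Y C) :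
  p \c i + q \c j = idm C -> retract C X \/ retract C Y.
Proof.
move=> pq; have ret Z (u : Mor C Z) (v : Mor Z C) : is_iso (v \c u) -> retract C Z.
  by case=> s [svu _]; exists u, (s \c v); rewrite -mcompA.
case: (indec_local (p \c i)) => [/ret|]; first by left.
by rewrite -pq addrC addKr => /ret; right.
Qed.

End Indecomposable.
End KrullSchmidt.

(** * Additive subcategories and the ideals of maps that factor through them *)

Section Additive.
Variables (k : fieldType) (T : linCat k).
Implicit Types D Q : T -> Prop.

Lemma additive_of_retracts D :
    (forall A X, retract A X -> D X -> D A) -> (forall X, is_zero X -> D X) ->
    (forall A B P, is_biproduct A B P -> D A -> D B -> D P) ->
  additive_subcat D.
Proof.
move=> Dr D0 Ds; split=> // [X Y [f [g [gf fg]]]|A B P [i [_ [p [_ [pi _ _ _ _]]]]]].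
  by apply: Dr; exists g, f.
by apply: Dr; exists i, p.
Qed.

Lemma addc_additive Q : additive_subcat (addc Q).
Proof.
split=> [X Y XY hX|X X0|A B P bip hA hB|A B P bip hP] D aD QD.
- exact: (additive_iso aD XY (hX D aD QD)).
- exact: (additive_zero aD X0).
- exact: (additive_sum aD bip (hA D aD QD) (hB D aD QD)).
- exact: (additive_summand aD bip (hP D aD QD)).
Qed.

Lemma addc_gen Q (X : T) : Q X -> addc Q X.
Proof. by move=> QX D _; apply. Qed.

Definition thru D (M N : T) (u : Mor M N) : Prop :=
  exists (Z : T) (t : Mor Z N) (s : Mor M Z), D Z /\ u = t \c s.

Lemma thru_comp D (M N M' N' : T) (x : Mor N N') (u : Mor M N) (y : Mor M' M) :
  thru D u -> thru D (x \c u \c y).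
Proof.
case=> [Z [t [s [DZ ->]]]]; exists Z, (x \c t), (s \c y); split=> //.
by rewrite !mcompA.
Qed.

End Additive.

Section Triangles.
Variables (k : fieldType) (T : triCat k).
Implicit Types D Q : T -> Prop.

Lemma thru0 D (M N : T) : additive_subcat D -> thru D (0 : Mor M N).
Proof.
move=> aD; have [Z Z0] := tri_zero T; exists Z, 0, 0.
by split; [exact: (additive_zero aD) | rewrite comp0m].
Qed.

Lemma thruD D (M N : T) (u v : Mor M N) :
  additive_subcat D -> thru D u -> thru D v -> thru D (u + v).
Proof.
move=> aD [Z [t [s [DZ ->]]]] [Z' [t' [s' [DZ' ->]]]].
have [P bip] := tri_biproduct Z Z'.
have DP := additive_sum aD bip DZ DZ'.
case: bip => [i1 [i2 [p1 [p2 [h1 h2 h3 h4 _]]]]].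
exists P, (t \c p1 + t' \c p2), (i1 \c s + i2 \c s'); split=> //.
rewrite compDm !compmD -!mcompA !(mcompA p1) !(mcompA p2) h1 h2 h3 h4.
by rewrite !comp0m !comp1m !compm0 addr0 add0r.
Qed.

Lemma thru_id D (M : T) :
  split_idempotents T -> additive_subcat D -> thru D (idm M) -> D M.
Proof.
move=> idem aD [Z [t [s [DZ ts]]]].
by apply: (retract_closed idem aD _ DZ); exists s, t.
Qed.

(** Objects of add(D u E) are retracts of sums of an object of [D] and one of
    [E]; a decomposition of the identity records this without naming the
    retraction. *)
Lemma addc_decomp D E (M : T) : additive_subcat D -> additive_subcat E ->
  addc (fun Y => D Y \/ E Y) M ->
  exists u v : Mor M M, [/\ thru D u, thru E v & u + v = idm M].
Proof.
move=> aD aE; move: M; set Q := (X in forall M, _ -> X M).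
suff aQ : additive_subcat Q.
  move=> M /(_ Q aQ); apply=> Y [DY|EY].
    exists (idm Y), 0; split; [|exact: thru0|by rewrite addr0].
    by exists Y, (idm Y), (idm Y); rewrite comp1m.
  exists 0, (idm Y); split; [exact: thru0| |by rewrite add0r].
  by exists Y, (idm Y), (idm Y); rewrite comp1m.
apply: additive_of_retracts.
- move=> A X [i [p pi]] [u [v [hu hv uv]]].
  exists (p \c u \c i), (p \c v \c i); split; try exact: thru_comp.
  by rewrite -compDm -compmD uv compm1.
- move=> X X0; exists 0, 0; split; [exact: thru0|exact: thru0|].
  by rewrite addr0 X0.
move=> A B P [i1 [i2 [p1 [p2 [_ _ _ _ h5]]]]].
move=> [u [v [hu hv uv]]] [u' [v' [hu' hv' uv']]].
exists (i1 \c u \c p1 + i2 \c u' \c p2), (i1 \c v \c p1 + i2 \c v' \c p2).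
split; try by apply: thruD => //; exact: thru_comp.
by rewrite addrACA -!compDm -!compmD uv uv' !compm1.
Qed.

(** * Triangles *)

Section Equivalence.
Variables (S S' : linCat k) (F : linFunctor S S').
Hypothesis eqF : is_equivalence F.

Lemma equiv_faithful (X Y : S) (f g : Mor X Y) : fmap F f = fmap F g -> f = g.
Proof.
have [G [u [v [iu iv nu nv]]]] := eqF; move=> fg.
have [w [wu _]] := iu Y.
by rewrite -(comp1m f) -(comp1m g) -wu -!mcompA !nu fg.
Qed.

Lemma equiv_full (X Y : S) (g : Mor (F X) (F Y)) : exists f, fmap F f = g.
Proof.
have [G [u [v [iu iv nu nv]]]] := eqF; have [w [wu uw]] := iu Y.
exists (w \c fmap G g \c u X).
have GF : fmap G (fmap F (w \c fmap G g \c u X)) = fmap G g.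
  have [w' [_ uw']] := iu X.
  rewrite -[LHS]compm1 -uw' mcompA -nu !mcompA uw comp1m.
  by rewrite -mcompA uw' compm1.
have [z [_ vz]] := iv (F X).
by rewrite -[LHS]compm1 -[RHS]compm1 -vz !mcompA -!nv GF.
Qed.

Lemma equiv_essential (Y : S') : exists (X : S) (f : Mor (F X) Y), is_iso f.
Proof. by have [G [u [v [_ iv _ _]]]] := eqF; exists (G Y), (v Y). Qed.

End Equivalence.

Local Notation sus := (fmap susp).

Lemma sus_inj (X Y : T) (f g : Mor X Y) : sus f = sus g -> f = g.
Proof. exact: equiv_faithful (susp_equivalence T) _ _ _ _. Qed.

Lemma sus_full (X Y : T) (g : Mor (susp X) (susp Y)) : exists f, sus f = g.
Proof. exact: equiv_full (susp_equivalence T) _ _ _. Qed.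

Lemma sus_zero (X : T) : is_zero X -> is_zero (susp X).
Proof. by rewrite /is_zero -fmap1 => ->; rewrite linear0. Qed.

Section OneTriangle.
Variables (X Y Z : T) (f : Mor X Y) (g : Mor Y Z) (h : Mor Z (susp X)).
Hypothesis tri : dist f g h.

Lemma dist_rot : dist g h (- sus f).
Proof. exact: (dist_rotate f g h).1. Qed.

Lemma dist_comp_gf : g \c f = 0.
Proof.
have [O O0] := tri_zero T.
have [c [<- _]] := dist_fill (dist_id X O0) tri (erefl (f \c idm X)).
by rewrite compm0.
Qed.

Lemma dist_lift_f (W : T) (l : Mor W Y) : g \c l = 0 -> exists m, l = f \c m.
Proof.
move=> gl; have [O O0] := tri_zero T.
have W0 := (dist_rotate _ _ _).1 (dist_id W O0).
have sq : (0 : Mor O Z) \c (0 : Mor W O) = g \c l by rewrite gl comp0m.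
have [c [_]] := dist_fill W0 dist_rot sq.
have [m <-] := sus_full c.
rewrite compmN compNm fmap1 compm1 => /oppr_inj; rewrite -fmap_comp => /sus_inj.
by exists m.
Qed.

Lemma dist_extend_g (W : T) (l : Mor Y W) : l \c f = 0 -> exists m, l = m \c g.
Proof.
move=> lf; have [O O0] := tri_zero T.
have W0 : dist (0 : Mor O W) (idm W) 0.
  by apply: (dist_rotate _ _ _).2; rewrite linear0 oppr0; exact: dist_id (sus_zero O0).
have sq : l \c f = (0 : Mor O W) \c (0 : Mor X O) by rewrite lf comp0m.
by have [c [cg _]] := dist_fill tri W0 sq; exists c; rewrite cg comp1m.
Qed.

End OneTriangle.

Section TriangleConsequences.
Variables (X Y Z : T) (f : Mor X Y) (g : Mor Y Z) (h : Mor Z (susp X)).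
Hypothesis tri : dist f g h.

Let tri1 := dist_rot tri.
Let tri2 := dist_rot tri1.

Lemma dist_comp_hg : h \c g = 0.
Proof. exact: dist_comp_gf tri1. Qed.

Lemma dist_comp_fh : sus f \c h = 0.
Proof.
by have := dist_comp_gf tri2; rewrite compNm => /eqP; rewrite oppr_eq0 => /eqP.
Qed.

Lemma dist_lift_g (W : T) (l : Mor W Z) : h \c l = 0 -> exists m, l = g \c m.
Proof. exact: dist_lift_f tri1 _ _. Qed.

Lemma dist_extend_h (W : T) (l : Mor Z W) : l \c g = 0 -> exists m, l = m \c h.
Proof. exact: dist_extend_g tri1 _ _. Qed.

Lemma dist_extend_f (W : T) (l : Mor X W) : sus l \c h = 0 -> exists m, l = m \c f.
Proof.
move=> lh; have [m lm] := dist_extend_g tri2 lh.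
have [m' mm] := sus_full m; exists (- m'); apply: sus_inj.
by rewrite lm fmap_comp linearN mm compmN compNm.
Qed.

Lemma split_epi_third0 : h = 0 <-> split_epi g.
Proof.
split=> [h0|[s gs]]; last by rewrite -(compm1 h) -gs mcompA dist_comp_hg comp0m.
have hid : h \c idm Z = 0 by rewrite h0 comp0m.
by have [s gs] := dist_lift_g hid; exists s.
Qed.

End TriangleConsequences.

Lemma dist_fill_mid (X Y Z X' Y' Z' : T)
    (f : Mor X Y) (g : Mor Y Z) (h : Mor Z (susp X))
    (f' : Mor X' Y') (g' : Mor Y' Z') (h' : Mor Z' (susp X'))
    (a : Mor X X') (c : Mor Z Z') :
  dist f g h -> dist f' g' h' -> sus a \c h = h' \c c ->
  exists b : Mor Y Y', b \c f = f' \c a /\ c \c g = g' \c b.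
Proof.
move=> tri tri' sq.
have [d [d1 d2]] := dist_fill (dist_rot (dist_rot tri)) (dist_rot (dist_rot tri')) sq.
have [b bd] := sus_full d; exists b; split; apply: sus_inj; rewrite !fmap_comp bd.
  by apply: oppr_inj; rewrite -compmN d1 compNm.
by apply: oppr_inj; rewrite -compmN d2 compNm.
Qed.

Lemma dist_on_third (X Z : T) (h : Mor Z (susp X)) :
  exists (Y : T) (f : Mor X Y) (g : Mor Y Z), dist f g h.
Proof.
have [W [r [s trs]]] := dist_cone h.
have [Y [v [v' [v'v vv']]]] := equiv_essential (susp_equivalence T) W.
have [f sf] := sus_full (v' \c r); have [g sg] := sus_full (s \c v).
exists Y, (- f), (- g); do 2!apply: (dist_rotate _ _ _).2.
rewrite !linearN !opprK sf sg.
by apply: (dist_iso (c := v') (iso_id Z) (iso_id _) _ _ _ _ trs);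
  [exists v | rewrite comp1m compm1 | rewrite compm1 |
   rewrite fmap1 comp1m -mcompA vv' compm1].
Qed.

Lemma dist_on_second (Y Z : T) (g : Mor Y Z) :
  exists (X : T) (f : Mor X Y) (h : Mor Z (susp X)), dist f g h.
Proof.
have [W [r [s trs]]] := dist_cone g.
have [X [v [v' [v'v vv']]]] := equiv_essential (susp_equivalence T) W.
have [f sf] := sus_full (s \c v).
exists X, (- f), (v' \c r); apply: (dist_rotate _ _ _).2; rewrite linearN opprK sf.
by apply: (dist_iso (c := v') (iso_id Y) (iso_id _) _ _ _ _ trs);
  [exists v | rewrite comp1m compm1 | rewrite compm1 |
   rewrite fmap1 comp1m -mcompA vv' compm1].
Qed.

(** The octahedral axiom for the composite of the desuspended [gamma] with
    [m]: the maps [xi] and [m] out of [X] have a common pushout [N], with the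
    expected cones [A] and [C]. *)
Lemma homotopy_pushout (X B C M A : T)
    (xi : Mor X B) (beta : Mor B C) (gamma : Mor C (susp X))
    (m : Mor X M) (q : Mor M A) (delta : Mor A (susp X)) :
  dist xi beta gamma -> dist m q delta ->
  exists (N : T) (u : Mor B N) (v : Mor N A) (j : Mor M N) (n : Mor N C),
    dist u v (sus xi \c delta) /\ dist j n (sus m \c gamma).
Proof.
move=> tri trm.
have [C0 [i [i' [i'i ii']]]] := equiv_essential (susp_equivalence T) C.
have [w sw] := sus_full (- (gamma \c i)).
have trw : dist w xi (i' \c beta).
  apply: (dist_rotate _ _ _).2; rewrite sw opprK.
  by apply: (dist_iso (c := i') (iso_id X) (iso_id _) _ _ _ _ tri);
    [exists i | rewrite comp1m compm1 | rewrite compm1 |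
     rewrite fmap1 comp1m -mcompA ii' compm1].
have [N [j [l trj]]] := dist_cone (m \c w).
have [u [v [tru _]]] := dist_octahedron trw trm trj.
exists N, u, v, j, (i \c l); split=> //.
apply: (dist_iso (c := i) (iso_id M) (iso_id _) _ _ _ _ (dist_rot trj));
  [by exists i' | by rewrite comp1m compm1 | by rewrite compm1 |].
by rewrite fmap1 comp1m fmap_comp sw compmN opprK mcompA.
Qed.
End Triangles.

(** * Almost split maps *)

Lemma right_minimal_version (k : fieldType) (T : linCat k) (D : T -> Prop)
    (B C : T) (b : Mor B C) :
  split_idempotents T -> additive_subcat D -> D B ->
  exists (B' : T) (b' : Mor B' C) (i : Mor B' B) (p : Mor B B'),
    [/\ D B', right_minimal b', b' = b \c i & b = b' \c p].
Proof.
move=> idem aD; have [n] := ubnP (\dim {:Mor B B}); elim: n B b => // n IH B b.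
rewrite ltnS => dB DB; case: (classic (right_minimal b)) => [bmin|nmin].
  by exists B, b, (idm B), (idm B); rewrite compm1.
have [p [bp np]] : exists p, b \c p = b /\ ~ is_iso p.
  by apply: NNPP => none; apply: nmin => p bp; apply: NNPP => np; apply: none; exists p.
case: (iso_or_idempotent p) => // [[f [ff f0 /(_ _ b bp) bf _]]].
have [Y [Z [i [r [j [q [bip ir _ jq _]]]]]]] := idempotent_biproduct idem ff.
have Y0 : ~ is_zero Y by move=> Y0; apply: f0; rewrite -ir (zero_cod r Y0) compm0.
have bip' := biproductC bip.
have dZ := leq_trans (summand_dim_lt bip' Y0) dB.
have [B' [b' [i' [p' [DB' mb' eb' eb]]]]] :=
  IH Z (b \c j) dZ (additive_summand aD bip' DB).
exists B', b', (j \c i'), (p' \c q); split=> //; first by rewrite mcompA.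
by rewrite mcompA -eb -mcompA jq compmB bf subr0 compm1.
Qed.

Lemma separating_functional (k : fieldType) (V : vectType k) (x : V) :
  x <> 0 -> exists phi : 'Hom(V, k^o), phi x <> 0.
Proof.
move=> x0; apply: NNPP => none; apply: x0.
rewrite (coord_vbasis (memvf x)); apply: big1 => i _.
suff -> : coord (vbasis fullv) i x = 0 by rewrite scale0r.
apply: NNPP => xi; apply: none.
by exists (linfun (coord (vbasis fullv) i : V -> k^o)); rewrite lfunE.
Qed.

(** An element of the socle of the right End(C)-module Hom(C, W): it generates
    a submodule of minimal dimension. *)
Lemma socle_element (k : fieldType) (T : linCat k) (C W : T) (h : Mor C W) :
  split_idempotents T -> indecomposable C -> h <> 0 ->
  exists2 h' : Mor C W, h' <> 0 & forall r : Mor C C, ~ is_iso r -> h' \c r = 0.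
Proof.
move=> idem indC.
pose M (x : Mor C W) := limg (linfun (postcomp x : Mor C C -> Mor C W)).
have [n] := ubnP (\dim (M h)); elim: n h => // n IH h; rewrite ltnS => dh h0.
case: (classic (exists2 r : Mor C C, ~ is_iso r & h \c r <> 0)) => [[r nr hr]|none].
  apply: (IH (h \c r)) => //; apply: (leq_trans _ dh); rewrite ltnNge; apply/negP => le.
  have /vspaceP/(_ h) : M (h \c r) = M h.
    apply/eqP; rewrite eqEdim le andbT; apply/subvP => _ /memv_imgP[x _ ->].
    by apply/memv_imgP; exists (r \c x); rewrite ?memvf // !lfunE /= /postcomp mcompA.
  have -> : h \in M h.
    by apply/memv_imgP; exists (idm C); rewrite ?memvf // lfunE /= /postcomp compm1.
  case/memv_imgP => x _; rewrite lfunE /= /postcomp => hrx.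
  case: (indec_local idem indC (r \c x)) => [/split_epi_of_iso_comp|[y [_ xy]]].
    by move/(indec_split_epi_iso idem indC).
  case: h0; rewrite -(compm1 h) -xy mcompA compmB compm1 mcompA -hrx subrr.
  by rewrite comp0m.
exists h => // r nr; apply: NNPP => hr; apply: none; by exists r.
Qed.

Lemma serre_socle (k : fieldType) (T : triCat k) (S : serreFunctor T) (C : T) :
  split_idempotents T -> indecomposable C ->
  exists2 h : Mor C (S C), h <> 0 &
    forall (C' : T) (g : Mor C' C), ~ split_epi g -> h \c g = 0.
Proof.
move=> idem indC.
have [h0 h00] : exists h0 : Mor C (S C), h0 <> 0.
  apply: NNPP => none; apply: indC.1; apply: (bij_inj (serre_bij S C C)).
  apply/lfunP => h; have -> : h = 0 by apply: NNPP => hn; apply: none; exists h.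
  by rewrite !linear0.
have [h hn hr] := socle_element idem indC h00; exists h => // C' g ng.
apply: NNPP => /separating_functional[phi]; case.
have [inv _ invK] := serre_bij S C C'.
have := serre_natural (idm C) g (inv phi) h.
rewrite invK compm1 fmap1 comp1m => <-.
have := serre_natural (idm C) (g \c inv phi) (idm C) h.
rewrite !compm1 fmap1 comp1m => ->.
by rewrite hr ?linear0 //; apply: nonsplit_postcomp.
Qed.

Section AlmostSplit.
Variables (k : fieldType) (T : triCat k) (CC : T -> Prop) (C : T).
Hypotheses (idem : split_idempotents T) (indC : indecomposable C).
Hypothesis (aCC : additive_subcat CC).

(** Maps that are not split epimorphisms are killed by the socle element [h],
    so they lift to its fibre [E], and from there to the precover of [E]. *)
Lemma almost_split_exists (S : serreFunctor T) : functorially_finite CC -> CC C ->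
  exists (B : T) (beta : Mor B C), minimal_right_almost_split CC beta.
Proof.
move=> ff CCC; have [h h0 hg] := serre_socle S idem indC.
have [E [f [w tri]]] := dist_on_second h.
have [[A [c [CA cov]]] _] := ff E.
have [B [b [i [p [CB minb bi bp]]]]] := right_minimal_version (f \c c) idem aCC CA.
exists B, b; split=> //; split=> // [[s bs]|C' g CC' ng].
  apply: h0; rewrite -(compm1 h) -bs bi !mcompA.
  by rewrite (dist_comp_gf tri) !comp0m.
have [l ->] := dist_lift_f tri (hg C' g ng); have [l' <-] := cov C' l CC'.
by exists (p \c l'); rewrite !mcompA bp.
Qed.

(** If [p] fixes [xi], the Fitting idempotent that kills [xi] factors through
    [beta] and so is conjugate to an idempotent of [C] that factors through
    [beta]; as [beta] is not a split epimorphism, it vanishes. *)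
Lemma almost_split_left_minimal (X B : T) (xi : Mor X B) (beta : Mor B C)
    (gamma : Mor C (susp X)) :
  dist xi beta gamma -> ~ split_epi beta -> left_minimal xi.
Proof.
move=> tri nsplit p pxi; case: (iso_or_idempotent p) => // [[f [ff f0 _]]].
move=> /(_ _ xi pxi) fxi; have [q fq] := dist_extend_g tri fxi.
have qfb : f \c q \c beta = f by rewrite -mcompA -fq.
have ee : (beta \c (f \c q)) \c (beta \c (f \c q)) = beta \c (f \c q).
  by rewrite -mcompA (mcompA (f \c q)) qfb (mcompA f) ff.
case: (indec_idempotent idem indC ee) => [bq0|bq1]; last first.
  by case: nsplit; exists (f \c q).
by case: f0; rewrite -ff -qfb -mcompA (mcompA beta) bq0 comp0m compm0.
Qed.

Lemma left_weak_AR_exists (S : serreFunctor T) :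
  functorially_finite CC -> Ext_projectives CC C ->
  exists (X B : T) (xi : Mor X B) (beta : Mor B C) (gamma : Mor C (susp X)),
    left_weak_AR_triangle CC xi beta gamma.
Proof.
move=> ff projC; have [B [beta ras]] := almost_split_exists S ff projC.1.
have [X [xi [gamma tri]]] := dist_on_second beta.
have [_ [CB _ nsplit _]] := ras.
exists X, B, xi, beta, gamma; split=> //; split; last first.
  exact: almost_split_left_minimal tri nsplit.
split=> // B' g CB'.
have [m ->] := dist_extend_f tri (projC.2 B' CB' (fmap susp g \c gamma)).
by exists m.
Qed.

End AlmostSplit.

(** * The modified subcategory *)

Section Mutation.
Variables (k : fieldType) (T : triCat k) (CC : T -> Prop) (C : T).
Hypotheses (idem : split_idempotents T) (indC : indecomposable C).
Hypotheses (aCC : additive_subcat CC) (eCC : extension_closed CC).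
Variables (X B : T) (xi : Mor X B) (beta : Mor B C) (gamma : Mor C (susp X)).
Hypothesis AR : left_weak_AR_triangle CC xi beta gamma.
Variable Ct : T -> Prop.
Hypothesis aCt : additive_subcat Ct.
Hypothesis IndCt : forall Y : T, Ind Ct Y <-> Ind CC Y /\ ~ isom Y C.

Local Notation sus := (fmap susp).
Local Notation addX := (addc (fun Y : T => Y = X)).
Local Notation CC' := (addc (fun Y : T => Ct Y \/ Y = X)).

Let tri : dist xi beta gamma. Proof. by case: AR. Qed.
Let CB : CC B. Proof. by case: AR => _ _ [_ []]. Qed.
Let CCC : CC C. Proof. by case: AR => _ []. Qed.
Let nsplit : ~ split_epi beta. Proof. by case: AR => _ _ [_ []]. Qed.
Let min_beta : right_minimal beta. Proof. by case: AR => _ _ []. Qed.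

Lemma gamma_neq0 : gamma <> 0.
Proof. by move/(split_epi_third0 tri). Qed.

Lemma gamma_kill (Y : T) (g : Mor Y C) : CC Y -> ~ split_epi g -> gamma \c g = 0.
Proof.
case: AR => _ _ [_ [_ _ _ fac]] _ CY /(fac Y g CY)[l <-].
by rewrite mcompA (dist_comp_hg tri) comp0m.
Qed.

Lemma split_epi_retract (Y : T) (g : Mor Y C) : split_epi g -> retract C Y.
Proof. by case=> s gs; exists s, g. Qed.

Lemma C_notin_Ct : ~ Ct C.
Proof.
move=> CtC; have [_] := (IndCt C).1 (conj indC CtC); apply.
by exists (idm C); exact: iso_id.
Qed.

Lemma Ct_sub_CC (Y : T) : Ct Y -> CC Y.
Proof.
elim/(@krull_schmidt_ind k T): Y => [Y Y0 _|Y indY CtY|M N P bip IHM IHN CtP].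
- exact: (additive_zero aCC).
- by have [[]] := (IndCt Y).1 (conj indY CtY).
apply: (additive_sum aCC bip); first by apply/IHM/(additive_summand aCt bip).
by apply/IHN/(additive_summand aCt (biproductC bip)).
Qed.

Lemma Ct_of_CC (Y : T) : CC Y -> ~ retract C Y -> Ct Y.
Proof.
elim/(@krull_schmidt_ind k T): Y => [Y Y0 _ _|Y indY CY nC|M N P bip IHM IHN CP nC].
- exact: (additive_zero aCt).
- have [] // := (IndCt Y).2 _; split=> // -[f [g [gf fg]]].
  by apply: nC; exists g, f.
have CM := additive_summand aCC bip CP.
have CN := additive_summand aCC (biproductC bip) CP.
have [i1 [i2 [p1 [p2 [h1 h2 _ _ _]]]]] := bip.
have up (Y : T) (i : Mor Y P) (p : Mor P Y) : p \c i = idm Y -> ~ retract C Y.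
  move=> pi [j [q qj]]; apply: nC; exists (i \c j), (q \c p).
  by rewrite -mcompA (mcompA p) pi comp1m.
by apply: (additive_sum aCt bip); [apply: IHM (up _ _ _ h1)|apply: IHN (up _ _ _ h2)].
Qed.

Lemma Ct_CC' (Y : T) : Ct Y -> CC' Y.
Proof. by move=> CtY; apply: addc_gen; left. Qed.

Lemma X_CC' : CC' X.
Proof. by apply: addc_gen; right. Qed.

Lemma addX_sub (D : T -> Prop) (Z : T) : additive_subcat D -> D X -> addX Z -> D Z.
Proof. by move=> aD DX /(_ D aD); apply=> _ ->. Qed.

Lemma CC'_decomp (M : T) : CC' M ->
  exists u v : Mor M M, [/\ thru Ct u, thru addX v & u + v = idm M].
Proof.
move=> hM; apply: (addc_decomp aCt (addc_additive _)) => D aD hD.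
by apply: hM aD _ => Y [CtY|->]; apply: hD; [left | right; exact: addc_gen].
Qed.

Lemma addX_proj_vanish (M N A : T) (v : Mor M N) (d : Mor N (susp A)) :
  Ext_projectives CC' X -> CC' A -> thru addX v -> d \c v = 0.
Proof.
move=> [_ projX] CA [Z [t [s [XZ ->]]]]; rewrite mcompA.
suff -> : d \c t = 0 by rewrite comp0m.
pose D (Y : T) := forall f : Mor Y (susp A), f = 0.
suff aD : additive_subcat D by apply: (addX_sub aD) XZ _; exact: projX.
apply: additive_of_retracts => [Y Y' [i [p pi]] D0 f|Y Y0 f|Y Y' P bip D1 D2 f].
- by rewrite -(compm1 f) -pi mcompA (D0 (f \c p)) comp0m.
- exact: zero_dom.
case: bip => [i1 [i2 [p1 [p2 [_ _ _ _ h]]]]].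
by rewrite -(compm1 f) -h compmD !mcompA (D1 (f \c i1)) (D2 (f \c i2)) !comp0m addr0.
Qed.

Lemma addX_inj_vanish (M N A : T) (v : Mor M N) (d : Mor A (susp M)) :
  Ext_injectives CC' X -> CC' A -> thru addX v -> sus v \c d = 0.
Proof.
move=> [_ injX] CA [Z [t [s [XZ ->]]]]; rewrite fmap_comp -mcompA.
suff -> : sus s \c d = 0 by rewrite compm0.
pose D (Y : T) := forall f : Mor A (susp Y), f = 0.
suff aD : additive_subcat D by apply: (addX_sub aD) XZ _; exact: injX.
apply: additive_of_retracts => [Y Y' [i [p pi]] D0 f|Y Y0 f|Y Y' P bip D1 D2 f].
- by rewrite -(comp1m f) -fmap1 -pi fmap_comp -mcompA (D0 (sus i \c f)) compm0.
- exact: zero_cod (sus_zero Y0).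
case: bip => [i1 [i2 [p1 [p2 [_ _ _ _ h]]]]].
rewrite -(comp1m f) -fmap1 -h linearD !fmap_comp compDm -!mcompA.
by rewrite (D1 (sus p1 \c f)) (D2 (sus p2 \c f)) !compm0 addr0.
Qed.

(** An extension of objects of Ct stays in Ct: a copy of [C] in the middle term
    would make [gamma] factor through a map from the last term to the
    suspension of [X]. *)
Lemma Ct_extension (A Y E : T) (a : Mor A Y) (b : Mor Y E) (d : Mor E (susp A)) :
  Ext_injectives CC' X -> dist a b d -> Ct A -> Ct E -> Ct Y.
Proof.
move=> [_ injX] tr CtA CtE; apply: Ct_of_CC.
  exact: eCC tr (Ct_sub_CC CtA) (Ct_sub_CC CtE).
move=> [i [p pi]].
have pa0 : gamma \c (p \c a) = 0.
  apply: gamma_kill; first exact: Ct_sub_CC.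
  by move/split_epi_retract=> /(retract_closed idem aCt)/(_ CtA)/C_notin_Ct.
rewrite mcompA in pa0; have [e ge] := dist_extend_g tr pa0.
have e0 : e = 0 := injX E (Ct_CC' CtE) e.
by case: gamma_neq0; rewrite -(compm1 gamma) -pi mcompA ge e0 !comp0m.
Qed.

(** The components of the connecting map [h] on summands of [X] vanish, so [h]
    comes from a map from [E0] to the suspension of [A0], with [A0] and [E0] in
    Ct; its fibre [B0] is in Ct too. The identity of the middle term is then a
    sum of maps through [B0], through an object of add(X), and through [A]. *)
Lemma CC'_extension_closed :
  Ext_projectives CC' X -> Ext_injectives CC' X -> extension_closed CC'.
Proof.
move=> projX injX A Y E a b h tr CA CE.
have aCC' := addc_additive (fun Y : T => Ct Y \/ Y = X).
have [uA [vA [[A0 [pA [iA [CtA euA]]]] tvA uvA]]] := CC'_decomp CA.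
have [uE [vE [[E0 [pE [iE [CtE euE]]]] tvE uvE]]] := CC'_decomp CE.
have hv : h \c vE = 0 := addX_proj_vanish h projX CA tvE.
have vh : sus vA \c h = 0 := addX_inj_vanish h injX CE tvA.
have hu : h \c (pE \c iE) = h by rewrite -euE -[RHS]compm1 -uvE compmD hv addr0.
have uh : sus (pA \c iA) \c h = h.
  by rewrite -euA -[RHS]comp1m -fmap1 -uvA linearD compDm vh addr0.
have [B0 [a0 [b0 tr0]]] := dist_on_third (sus iA \c h \c pE).
have CtB0 := Ct_extension injX tr0 CtA CtE.
have sqf : sus iA \c h = (sus iA \c h \c pE) \c iE by rewrite -!mcompA hu.
have [f [_ bf]] := dist_fill_mid tr tr0 sqf.
have sqg : sus pA \c (sus iA \c h \c pE) = h \c pE.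
  by rewrite !mcompA -fmap_comp uh.
have [g [_ bg]] := dist_fill_mid tr0 tr sqg.
have [Z [t [s [XZ evE]]]] := tvE.
have ht : h \c t = 0.
  apply: (addX_proj_vanish h projX CA).
  by exists Z, t, (idm Z); rewrite compm1.
have [t' tt'] := dist_lift_g tr ht.
pose r := idm Y - g \c f - t' \c (s \c b).
have br : b \c r = 0.
  rewrite /r !compmB compm1 !mcompA -tt' -bg -!mcompA -bf (mcompA pE) -euE.
  by rewrite (mcompA t) -evE -{1}[b]comp1m -uvE compDm addrAC addrK subrr.
have [w rw] := dist_lift_f tr br.
apply: (thru_id idem aCC').
have -> : idm Y = g \c f + t' \c (s \c b) + a \c w.
  by rewrite -rw /r -[idm Y - _ - _]addrA -opprD [RHS]addrC subrK.
apply: thruD => //; last by exists A, a, w.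
apply: thruD => //; first by exists B0, g, f; split=> //; exact: Ct_CC'.
exists Z, t', (s \c b); split=> //; exact: (addX_sub aCC' X_CC').
Qed.

Lemma C_in_CC' : CC' C -> retract C X.
Proof.
move=> hC; have [u [v [[A [p [i [CtA ->]]]] [Z [q [j [XZ ->]]]] uv]]] := CC'_decomp hC.
case: (indec_sum idem indC uv) => [/(retract_closed idem aCt)/(_ CtA)/C_notin_Ct //|].
pose D (Y : T) := retract C Y -> retract C X.
suff aD : additive_subcat D by apply: (addX_sub aD) XZ.
apply: additive_of_retracts => [Y Y' [i1 [p1 pi]] DY'|Y Y0|Y Y' P bip D1 D2]; rewrite /D.
- move=> [i2 [p2 pi2]]; apply: DY'; exists (i1 \c i2), (p2 \c p1).
  by rewrite -mcompA (mcompA p1) pi comp1m.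
- move=> [i2 [p2 pi2]]; case: indC.1.
  by rewrite /is_zero -pi2 (zero_dom p2 Y0) comp0m.
move=> [i' [p' pi']]; case: bip => [i1 [i2 [p1 [p2 [_ _ _ _ h]]]]].
have e : (p' \c i1) \c (p1 \c i') + (p' \c i2) \c (p2 \c i') = idm C.
  by rewrite -!mcompA -compmD !mcompA -compDm h comp1m.
by case: (indec_sum idem indC e).
Qed.

(** If [C] were a summand of [B], then by minimality [beta] would not vanish
    on it; but a nonzero endomorphism of [C] is invertible, so [beta] would be
    a split epimorphism. *)
Lemma B_in_Ct : End_division_ring C -> Ct B.
Proof.
move=> [_ divC]; apply: Ct_of_CC => // -[i [p pi]].
have bi0 : beta \c i = 0.
  by apply: NNPP => /divC/split_epi_of_iso_comp.
have fix_beta : beta \c (idm B - i \c p) = beta.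
  by rewrite compmB compm1 mcompA bi0 comp0m subr0.
have [q [qe _]] := min_beta fix_beta.
case: indC.1; rewrite /is_zero -pi.
have -> : i = 0; last by rewrite compm0.
by rewrite -(comp1m i) -qe -mcompA compBm comp1m -mcompA pi compm1 subrr compm0.
Qed.

(** The Fitting idempotent of [sus e] that kills [gamma] factors through [xi]
    and so is conjugate to an idempotent of [B] killed by [beta], which must
    vanish since [beta] is right minimal. *)
Lemma iso_of_fix_gamma (e : Mor X X) : sus e \c gamma = gamma -> is_iso e.
Proof.
move=> eg; case: (iso_or_idempotent (sus e)) => [[g [ge eg']]|].
  have [g' gg] := sus_full g; exists g'.
  by split; apply: sus_inj; rewrite fmap_comp fmap1 gg.
case=> [f [ff f0 _ /(_ _ gamma eg)]]; have [f' ef] := sus_full f.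
rewrite -ef => /(dist_extend_f tri)[m fm].
have ff' : f' \c f' = f' by apply: sus_inj; rewrite fmap_comp ef.
have qx : f' \c m \c xi = f' by rewrite -mcompA -fm.
have fix_beta : beta \c (idm B - xi \c (f' \c m)) = beta.
  by rewrite compmB compm1 mcompA (dist_comp_gf tri) comp0m subr0.
have [r [rq _]] := min_beta fix_beta.
have xq0 : xi \c (f' \c m) = 0.
  rewrite -[LHS]comp1m -rq -mcompA compBm comp1m -mcompA (mcompA (f' \c m)) qx.
  by rewrite (mcompA f') ff' subrr compm0.
by case: f0; rewrite -ef -ff' -qx -mcompA (mcompA xi) xq0 comp0m compm0 linear0.
Qed.

Lemma X_notin_CC : ~ CC X.
Proof.
case: AR => _ _ _ [[_ pre] _] CX; have [h hx] := pre X (idm X) CX.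
apply: gamma_neq0; rewrite -(comp1m gamma) -fmap1 -hx fmap_comp -mcompA.
by rewrite (dist_comp_fh tri) compm0.
Qed.

Lemma division_ring_C_notin_CC' : End_division_ring X -> ~ CC' C.
Proof.
move=> [_ divX] /C_in_CC'[i [p pi]].
have ip0 : i \c p <> 0.
  move=> ip0; apply: indC.1; rewrite /is_zero -(comp1m (idm C)) -pi.
  by rewrite -mcompA (mcompA i) ip0 comp0m compm0.
have [g [_ ipg]] := divX _ ip0; apply: X_notin_CC; apply: (additive_iso aCC) CCC.
by exists i; apply: (is_iso_lr (g' := p \c g) pi); rewrite mcompA.
Qed.

Lemma projective_C_notin_CC' : Ext_projectives CC' X -> ~ CC' C.
Proof.
move=> [_ projX] /C_in_CC'[i [p pi]]; apply: gamma_neq0.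
by rewrite -(compm1 gamma) -pi mcompA (projX X X_CC' (gamma \c p)) comp0m.
Qed.

Lemma division_ring_addX (Z : T) (x : Mor X Z) : End_division_ring X -> addX Z ->
  x = 0 \/ exists y : Mor Z X, y \c x = idm X.
Proof.
move=> [_ divX] XZ; move: Z XZ x.
pose D (Z : T) := forall x : Mor X Z, x = 0 \/ exists y : Mor Z X, y \c x = idm X.
suff aD : additive_subcat D.
  move=> Z XZ; apply: (addX_sub aD) XZ => x.
  case: (classic (x = 0)) => [|/divX[y [yx _]]]; first by left.
  by right; exists y.
apply: additive_of_retracts => [Z Z' [i [p pi]] DZ' x|Z Z0 x|Z Z' P bip D1 D2 x].
- case: (DZ' (i \c x)) => [ix0|[y yx]]; last by right; exists (y \c i); rewrite -mcompA.
  by left; rewrite -(comp1m x) -pi -mcompA ix0 compm0.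
- by left; exact: zero_cod.
case: bip => [i1 [i2 [p1 [p2 [_ _ _ _ h]]]]].
case: (D1 (p1 \c x)) => [x1|[y yx]]; last by right; exists (y \c p1); rewrite -mcompA.
case: (D2 (p2 \c x)) => [x2|[y yx]]; last by right; exists (y \c p2); rewrite -mcompA.
by left; rewrite -(comp1m x) -h compDm -!mcompA x1 x2 !compm0 addr0.
Qed.

Lemma no_retraction (M A : T) (m : Mor X M) (q : Mor M A) (delta : Mor A (susp X))
    (y : Mor M X) : dist m q delta -> y \c m = idm X -> delta = 0.
Proof.
move=> trm ym; rewrite -(comp1m delta) -fmap1 -ym fmap_comp -mcompA.
by rewrite (dist_comp_fh trm) compm0.
Qed.

(** Let [M] be the extension of [A] by [X] given by a nonzero [delta]. A
    component of [m] with values in a copy of [X] would be zero or a split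
    monomorphism, so [m] factors through Ct and hence through [xi]. Then [C]
    splits off the pushout [N], which is an extension of [A] by [B] and lies
    in CC', contrary to the absence of [C] from CC'. *)
Lemma division_rings_injective :
  End_division_ring X -> End_division_ring C -> extension_closed CC' ->
  Ext_injectives CC' X.
Proof.
move=> divX divC eCC'; split=> [|A CA delta]; first exact: X_CC'.
apply: NNPP => delta0.
have [M [m [q trm]]] := dist_on_third delta.
have [N [u [v [j [n [trN trn]]]]]] := homotopy_pushout tri trm.
have CM := eCC' _ _ _ _ _ _ trm X_CC' CA.
have CN := eCC' _ _ _ _ _ _ trN (Ct_CC' (B_in_Ct divC)) CA.
have [u' [v' [[A0 [p [i [CtA0 eu]]]] [Z [t [s [XZ ev]]]] uv]]] := CC'_decomp CM.
have sm : s \c m = 0.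
  case: (division_ring_addX (s \c m) divX XZ) => // -[y yx].
  by case: delta0; apply: (no_retraction (y := y \c s) trm); rewrite -mcompA.
have [y ym] : exists y : Mor B A0, y \c xi = i \c m.
  by case: AR => _ _ _ [[_ pre] _]; apply: pre; exact: Ct_sub_CC.
have me : m = p \c y \c xi.
  by rewrite -mcompA ym -[LHS]comp1m -uv compDm eu ev -!mcompA sm compm0 addr0.
have : split_epi n.
  apply/(split_epi_third0 trn).
  by rewrite me fmap_comp -mcompA (dist_comp_fh tri) compm0.
move/split_epi_retract=> rCN; apply: (division_ring_C_notin_CC' divX).
by apply: (retract_closed idem _ rCN CN); exact: addc_additive.
Qed.

(** For [A] in Ct, the pushout [N] lies in both CC and CC', so it has no summand
    [C]; hence [gamma] vanishes on [N] and factors through the suspension of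
    [m]. This provides a retraction of [m]. *)
Lemma projective_injective :
  End_division_ring C -> extension_closed CC' -> Ext_projectives CC' X ->
  Ext_injectives CC' X.
Proof.
move=> divC eCC' projX; split=> [|A CA delta]; first exact: X_CC'.
have Ct0 A0 (d : Mor A0 (susp X)) : Ct A0 -> d = 0.
  move=> CtA0; have [M [m [q trm]]] := dist_on_third d.
  have [N [u [v [j [n [trN trn]]]]]] := homotopy_pushout tri trm.
  have CN := eCC trN CB (Ct_sub_CC CtA0).
  have CN' := eCC' _ _ _ _ _ _ trN (Ct_CC' (B_in_Ct divC)) (Ct_CC' CtA0).
  have gn : gamma \c n = 0.
    apply: gamma_kill => // /split_epi_retract rCN.
    apply: (projective_C_notin_CC' projX).
    by apply: (retract_closed idem _ rCN CN'); exact: addc_additive.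
  have [x xe] := dist_extend_h trn gn; have [y yx] := sus_full x.
  have [z [zy _]] : is_iso (y \c m).
    by apply: iso_of_fix_gamma; rewrite fmap_comp yx -mcompA -xe.
  by apply: (no_retraction (y := z \c y) trm); rewrite -mcompA.
have [u [v [[A0 [p [i [CtA0 eu]]]] tv uv]]] := CC'_decomp CA.
rewrite -(compm1 delta) -uv compmD (addX_proj_vanish _ projX X_CC' tv) addr0 eu.
by rewrite mcompA (Ct0 _ (delta \c p) CtA0) comp0m.
Qed.

End Mutation.

Theorem theoremB (k : fieldType) (T : triCat k) (S : serreFunctor T)
    (Tsmall : skeletally_small T) (Tidem : split_idempotents T)
    (CC : T -> Prop) (CC_additive : additive_subcat CC)
    (CC_ext : extension_closed CC) (CC_ff : functorially_finite CC)
    (C : T) (C_indec : indecomposable C) (C_proj : Ext_projectives CC C) :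
  (exists (X B : T) (xi : Mor X B) (beta : Mor B C) (gamma : Mor C (susp X)),
     left_weak_AR_triangle CC xi beta gamma) /\
  (forall (X B : T) (xi : Mor X B) (beta : Mor B C) (gamma : Mor C (susp X)),
     left_weak_AR_triangle CC xi beta gamma ->
   forall Ct : T -> Prop,
     additive_subcat Ct ->
     (forall Y : T, Ind Ct Y <-> Ind CC Y /\ ~ isom Y C) ->
   let CC' := addc (fun Y : T => Ct Y \/ Y = X) in
   [/\ (* (a) *)
       Ext_projectives CC' X /\ Ext_injectives CC' X -> extension_closed CC',
       (* (b) *)
       End_division_ring X -> End_division_ring C -> extension_closed CC' ->
       Ext_injectives CC' X
     & (* (c) *)
       End_division_ring C -> extension_closed CC' -> Ext_projectives CC' X ->
       Ext_injectives CC' X]).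
Proof.
split; first exact: left_weak_AR_exists.
move=> X B xi beta gamma AR Ct aCt IndCt CC'; split.
- case=> projX injX.
  by apply: (CC'_extension_closed (CC := CC) (C := C)) => //; exact: AR.
- exact: (division_rings_injective (CC := CC) (C := C) _ _ _ AR).
exact: (projective_injective (CC := CC) (C := C) _ _ _ _ AR).
Qed.
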